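(* For every odd positive integer $n$, the ARS matching $\Xi_n$ is a rainbow near-perfect matching in $K^\bullet_n$, i.e. a set of $(n-1)/2$ pairwise vertex-disjoint edges of $K^\bullet_n$ having pairwise distinct colors.
   Context: For an integer $n\ge 1$, $K^\bullet_n$ denotes the complete graph on vertex set $\{0,1,\ldots,n-1\}$ whose edges are colored by the circular-distance edge coloring: the edge $\{i,j\}$ receives color $c_{\min\{|i-j|,\,n-|i-j|\}}$, where $c_1,c_2,\ldots$ are distinct colors; exactly $\lfloor n/2\rfloor$ colors are used. For odd $n$, a rainbow near-perfect matching is a matching with $(n-1)/2$ edges whose colors are pairwise distinct (exactly one vertex is unmatched). The ARS (arch-recursive-slide) matching $\Xi_n$, for odd $n\ge 1$, is defined recursively by $\Xi_n=\Xi'_n\cup\Xi''_n\cup\Xi'''_n$, where $\Xi'_1=\Xi''_1=\Xi'''_1=\emptyset$, and for $n\ge 3$ write $n=8k+r$ with $k\ge 0$ an integer and $r\in\{1,3,5,7\}$; then: $\Xi'_n=\{\{i,2k-1-i\}: i=0,\ldots,k-1\}$ if $r\in\{1,3\}$, and $\Xi'_n=\{\{i,2k+1-i\}: i=0,\ldots,k\}$ if $r\in\{5,7\}$; $\Xi''_n=\{\{2k+i,4k+1+2i\}: i=0,\ldots,2k-1\}$ if $r=1$; $\{\{2k+i,4k+1+2i\}: i=0,\ldots,2k\}$ if $r=3$; $\{\{2k+2+i,4k+4+2i\}: i=0,\ldots,2k\}$ if $r=5$; $\{\{2k+2+i,4k+4+2i\}: i=0,\ldots,2k+1\}$ if $r=7$;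 $\Xi'''_n=\{\{s+2i,\,s+2j\}: \{i,j\}\in \Xi_{2k+1}\}$ where $s=4k$ if $r=1$, $s=4k+2$ if $r=3$, $s=4k+3$ if $r=5$, $s=4k+5$ if $r=7$. (Index ranges with upper bound below the lower bound give the empty set.) *)

(* Defs.v *)
From mathcomp Require Import all_boot finmap zify.

Set Implicit Arguments.
Unset Strict Implicit.
Unset Printing Implicit Defensive.

Local Open Scope fset_scope.
Local Open Scope nat_scope.

(* Vertices are natural numbers and edges are finite sets of vertices. *)
Definition K_edge (n : nat) (e : {fset nat}) : Prop :=
  #|` e| = 2 /\ (forall v, v \in e -> v < n).

(* |i - j|, with the truncated subtraction of nat. *)
Definition absdiff (i j : nat) : nat := maxn i j - minn i j.

Definition circ_dist (n i j : nat) : nat := minn (absdiff i j) (n - absdiff i j).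

(* The index of the color of an edge. On a pair the maximum is attained at its
   two endpoints, because circ_dist vanishes on the diagonal; see
   circ_color_pair. *)
Definition circ_color (n : nat) (e : {fset nat}) : nat :=
  \max_(i <- e) \max_(j <- e) circ_dist n i j.

Lemma circ_distii (n i : nat) : circ_dist n i i = 0.
Proof. by rewrite /circ_dist /absdiff; lia. Qed.

Lemma circ_distC (n i j : nat) : circ_dist n i j = circ_dist n j i.
Proof. by rewrite /circ_dist /absdiff (maxnC i) (minnC i). Qed.

Lemma circ_color_pair (n i j : nat) :
  circ_color n [fset i; j] = circ_dist n i j.
Proof.
apply/eqP; rewrite eqn_leq; apply/andP; split.
  apply/bigmax_leqP_seq => a; rewrite !inE => ha _.
  apply/bigmax_leqP_seq => b; rewrite !inE => hb _.
  by case/orP: ha => /eqP->; case/orP: hb => /eqP->;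
    rewrite ?circ_distii // circ_distC.
have hi : i \in [fset i; j] by rewrite !inE eqxx.
have hj : j \in [fset i; j] by rewrite !inE eqxx orbT.
have le_row : circ_dist n i j <= \max_(b <- [fset i; j]) circ_dist n i b.
  exact: (leq_bigmax_seq (F := circ_dist n i) j hj).
apply: leq_trans le_row _.
exact: (leq_bigmax_seq (F := fun a => \max_(b <- [fset i; j]) circ_dist n a b)
          i hi).
Qed.

Definition is_matching (n : nat) (M : {fset {fset nat}}) : Prop :=
  (forall e : {fset nat}, e \in M -> K_edge n e) /\
  (forall e f : {fset nat},
      e \in M -> f \in M -> e <> f -> [disjoint e & f]).

Definition is_rainbow (n : nat) (M : {fset {fset nat}}) : Prop :=
  forall e f : {fset nat},
    e \in M -> f \in M -> e <> f -> circ_color n e <> circ_color n f.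

Definition rainbow_near_perfect_matching
    (n : nat) (M : {fset {fset nat}}) : Prop :=
  [/\ is_matching n M, #|` M| = (n - 1) %/ 2 & is_rainbow n M].

(* In the next definitions n = 8 * k + r; values of r other than 1, 3, 5, 7 are
   irrelevant. *)
Definition ars_arch (k r : nat) : {fset {fset nat}} :=
  match r with
  | 1 | 3 => [fset [fset i; 2 * k - 1 - i] | i in iota 0 k]
  | 5 | 7 => [fset [fset i; 2 * k + 1 - i] | i in iota 0 (k + 1)]
  | _ => fset0
  end.

Definition ars_slide (k r : nat) : {fset {fset nat}} :=
  match r with
  | 1 => [fset [fset 2 * k + i; 4 * k + 1 + 2 * i] | i in iota 0 (2 * k)]
  | 3 => [fset [fset 2 * k + i; 4 * k + 1 + 2 * i] | i in iota 0 (2 * k + 1)]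
  | 5 => [fset [fset 2 * k + 2 + i; 4 * k + 4 + 2 * i]
           | i in iota 0 (2 * k + 1)]
  | 7 => [fset [fset 2 * k + 2 + i; 4 * k + 4 + 2 * i]
           | i in iota 0 (2 * k + 2)]
  | _ => fset0
  end.

Definition ars_shift (k r : nat) : nat :=
  match r with
  | 1 => 4 * k
  | 3 => 4 * k + 2
  | 5 => 4 * k + 3
  | 7 => 4 * k + 5
  | _ => 0
  end.

Definition ars_copy (s : nat) (M : {fset {fset nat}}) : {fset {fset nat}} :=
  [fset [fset s + 2 * v | v in (e : {fset nat})] | e in M].

Fixpoint ars_fuel (fuel n : nat) : {fset {fset nat}} :=
  if fuel is fuel'.+1 then
    if n < 3 then fset0 else
    let k := n %/ 8 in
    let r := n %% 8 in
    ars_arch k r `|` ars_slide k r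
      `|` ars_copy (ars_shift k r) (ars_fuel fuel' (2 * k + 1))
  else fset0.

(* Fuel n suffices, since 2 * (n %/ 8) + 1 < n whenever 3 <= n; the recursive
   equations are ars1 and arsE. *)
Definition ars (n : nat) : {fset {fset nat}} := ars_fuel n n.

Lemma ars_fuel_enough (f g n : nat) :
  n <= f -> n <= g -> ars_fuel f n = ars_fuel g n.
Proof.
elim: f g n => [|f IH] [|g] n //=.
- by rewrite leqn0 => /eqP->.
- by move=> _; rewrite leqn0 => /eqP->.
move=> hf hg; case: ltnP => // n3.
by rewrite (IH g) //; lia.
Qed.

Lemma ars1 : ars 1 = fset0.
Proof. by []. Qed.

Lemma arsE (n k r : nat) : 3 <= n -> n = 8 * k + r -> r \in [:: 1; 3; 5; 7] ->
  ars n = ars_arch k r `|` ars_slide k r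
            `|` ars_copy (ars_shift k r) (ars (2 * k + 1)).
Proof.
move=> n3 nE hr.
have r8 : r < 8 by move: hr; rewrite !inE; lia.
have kE : n %/ 8 = k by lia.
have rE : n %% 8 = r by lia.
rewrite /ars; case: n n3 nE kE rE => // n n3 nE kE rE.
rewrite [LHS]/= ltnNge n3 /= kE rE.
by rewrite (@ars_fuel_enough n (2 * k + 1)) //; lia.
Qed.

Lemma ars_copy_pair (s i j : nat) :
  [fset s + 2 * v | v in [fset i; j]] = [fset s + 2 * i; s + 2 * j].
Proof.
apply/fsetP => x; apply/imfsetP/idP => /=.
  by case=> v; rewrite !inE => /orP[]/eqP-> ->; rewrite eqxx ?orbT.
rewrite !inE => /orP[]/eqP->; [exists i | exists j] => //=;
  by rewrite !inE eqxx ?orbT.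
Qed.

(* Main.v *)
Require Import Defs.
From mathcomp Require Import all_boot finmap.
From mathcomp Require Import zify.

(** Colors of a copied matching double as long as no edge wraps around the
    circle, so the induction carries the stronger claim that the ordinary
    distances [|i - j|] are pairwise distinct and at most [n./2] (hence equal to
    the colors). With arch size [m], the arch realizes odd distances below [2m],
    the copy even distances up to [2k], and the slide consecutive distances
    beyond both; the slide's right ends and the copy's vertices have opposite
    parities, so they interleave without meeting. *)

Set Implicit Arguments.
Unset Strict Implicit.
Unset Printing Implicit Defensive.

Local Open Scope fset_scope.
Local Open Scope nat_scope.

Definition edge_set (l : seq (nat * nat)) : {fset {fset nat}} :=
  [fset [fset p.1; p.2] | p in l].

(** Merging shared vertices and equal distances into one relation lets a single separation property
    give disjointness and distinct colors at once. The truncated differences are true distances on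
    pairs listed smaller end first. *)
Definition conflict (p q : nat * nat) : Prop :=
  p.1 = q.1 \/ p.1 = q.2 \/ p.2 = q.1 \/ p.2 = q.2 \/
  p.2 - p.1 = q.2 - q.1.

Definition rainbow_pairs (n : nat) (l : seq (nat * nat)) : Prop :=
  [/\ forall p : nat * nat, p \in l -> p.1 < p.2 < n /\ p.2 - p.1 <= n./2,
      forall p q : nat * nat, p \in l -> q \in l -> conflict p q -> p = q,
      uniq l & size l = n./2].

Definition arch_pairs (m : nat) : seq (nat * nat) :=
  [seq (i, 2 * m - 1 - i) | i <- iota 0 m].

Definition slide_pairs (a b t : nat) : seq (nat * nat) :=
  [seq (a + i, b + 2 * i) | i <- iota 0 t].

Definition copy_pairs (s : nat) (l : seq (nat * nat)) : seq (nat * nat) :=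
  [seq (s + 2 * p.1, s + 2 * p.2) | p <- l].

Lemma edge_setP (l : seq (nat * nat)) (e : {fset nat}) :
  reflect (exists2 p : nat * nat, p \in l & e = [fset p.1; p.2])
          (e \in edge_set l).
Proof. exact: imfsetP. Qed.

Lemma edge_set_cat l1 l2 : edge_set (l1 ++ l2) = edge_set l1 `|` edge_set l2.
Proof.
apply/fsetP => e; rewrite in_fsetU; apply/imfsetP/orP => /=.
  case=> p; rewrite mem_cat => /orP[] hp ->; [left | right];
    by apply/imfsetP; exists p.
by case=> /imfsetP[p /= hp ->]; exists p; rewrite // mem_cat hp ?orbT.
Qed.

Lemma edge_set_map (f : nat -> nat * nat) (s : seq nat) :
  edge_set [seq f i | i <- s] = [fset [fset (f i).1; (f i).2] | i in s].
Proof.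
apply/fsetP => e; apply/imfsetP/imfsetP => /=.
  by case=> _ /mapP[i hi ->] ->; exists i.
by case=> i hi ->; exists (f i); rewrite // map_f.
Qed.

Lemma edge_set_copy s l : edge_set (copy_pairs s l) = ars_copy s (edge_set l).
Proof.
apply/fsetP => e; apply/imfsetP/imfsetP => /=.
  case=> _ /mapP[p hp ->] ->; exists [fset p.1; p.2].
    by apply/imfsetP; exists p.
  by rewrite ars_copy_pair.
case=> _ /imfsetP[p /= hp ->] ->; exists (s + 2 * p.1, s + 2 * p.2).
  by apply/mapP; exists p.
by rewrite ars_copy_pair.
Qed.

Lemma rainbow_pairs_matching n l :
  odd n -> rainbow_pairs n l -> rainbow_near_perfect_matching n (edge_set l).
Proof.
move=> on [hl hc ul sl]; split.
- split.
    move=> _ /edge_setP[p /hl[p12 _] ->]; split.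
      by case/andP: p12 => p12 _; rewrite cardfs2 neq_ltn p12.
    by move=> v; rewrite !inE => /orP[] /eqP->; lia.
  move=> _ _ /edge_setP[p hp ->] /edge_setP[q hq ->] npq.
  apply/fdisjointP => v; rewrite !inE => vp; apply/negP => vq; apply: npq.
  have -> // : p = q; apply: hc => //.
  by move: vp vq; rewrite /conflict; lia.
- rewrite card_in_imfset /=.
    by rewrite undup_id // sl; lia.
  (* Equal edges share the endpoint [p.1], which is already a conflict. *)
  move=> p q /= hp hq e; apply: hc => //.
  have : p.1 \in [fset q.1; q.2] by rewrite -e !inE eqxx.
  by rewrite !inE /conflict => /orP[] /eqP; tauto.
- move=> _ _ /edge_setP[p hp ->] /edge_setP[q hq ->] npq.
  rewrite !circ_color_pair => e; apply: npq.
  have -> // : p = q; apply: hc => //; rewrite /conflict.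
  (* A distance d at most [n./2] satisfies d <= n - d, so the minimum in [circ_dist] is d. *)
  by move: (hl p hp) (hl q hq) e; rewrite /circ_dist /absdiff; lia.
Qed.

(** Treats the four residues uniformly: [m] arches, [t] slide edges with right ends from [b], copy
    shifted by [s]. The shortest slide edge has length [b - 2 * m]: [4 * m <= b] puts it above the
    arches, [2 * k + 2 * m < b] above the copy, and [b <= 3 * m + k + 1] keeps the longest one
    within [n./2]. The bounds by [2 * m + t] place right ends and copy past the arches and left
    ends; the last two hypotheses keep them below [n]. *)
Lemma rainbow_pairs_step n k m t b s l :
    rainbow_pairs (2 * k + 1) l ->
    n = 2 * (m + t + k) + 1 -> odd (b + s) ->
    4 * m <= b <= 3 * m + k + 1 -> 2 * k + 2 * m < b ->
    2 * m + t <= b -> 2 * m + t <= s ->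
    b + 2 * t < n + 2 -> s + 4 * k < n ->
  rainbow_pairs n
    (arch_pairs m ++ slide_pairs (2 * m) b t ++ copy_pairs s l).
Proof.
case=> hl hc ul sl nE bs bm kb tb ts bn sn.
have k2 : (2 * k + 1)./2 = k by lia.
rewrite k2 in hl sl.
have memP (p : nat * nat) :
  p \in arch_pairs m ++ slide_pairs (2 * m) b t ++ copy_pairs s l ->
  [\/ exists2 i, i < m & p = (i, 2 * m - 1 - i),
      exists2 i, i < t & p = (2 * m + i, b + 2 * i)
    | exists2 q : nat * nat, q \in l & p = (s + 2 * q.1, s + 2 * q.2)].
  rewrite !mem_cat => /or3P[] /mapP[i hi ->].
  - by constructor 1; exists i => //; move: hi; rewrite mem_iota; lia.
  - by constructor 2; exists i => //; move: hi; rewrite mem_iota; lia.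
  - by constructor 3; exists i.
split.
- by move=> p /memP[] [q hq ->] /=; last move: (hl q hq); lia.
- move=> p q /memP[] [i hi ->] /memP[] [j hj ->]; rewrite /conflict /=.
  + by move=> c; have -> : i = j by lia.
  + by lia.
  + by move: (hl j hj); lia.
  + by lia.
  + by move=> c; have -> : i = j by lia.
  + by move: (hl j hj); lia.
  + by move: (hl i hi); lia.
  + by move: (hl i hi); lia.
  (* Doubling and shifting create no new conflicts, so this one descends to [l]. *)
  + move=> c; have -> // : i = j.
    by apply: hc => //; rewrite /conflict; move: (hl i hi) (hl j hj); lia.
- rewrite !cat_uniq; apply/and5P; split.
  + by rewrite map_inj_uniq ?iota_uniq // => i j [].
  + apply/hasPn => p; rewrite mem_cat => hp.
    apply/negP => /mapP[i]; rewrite mem_iota => hi pE; subst p.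
    by case/orP: hp => /mapP[j hj [e1 e2]]; lia.
  + by rewrite map_inj_uniq ?iota_uniq // => i j []; lia.
  + apply/hasPn => _ /mapP[p hp ->]; apply/negP => /mapP[j hj [e1 e2]].
    by move: (hl p hp); lia.
  + by rewrite map_inj_uniq // => -[a c] [a' c'] [] /= e1 e2; congr pair; lia.
- by rewrite !size_cat !size_map !size_iota sl; lia.
Qed.

Lemma ars_rainbow_pairs n : odd n ->
  exists2 l, ars n = edge_set l & rainbow_pairs n l.
Proof.
elim/ltn_ind: n => n IH on.
have [n3|n3] := ltnP n 3.
  have -> : n = 1 by lia.
  exists [::]; last by split.
  rewrite ars1; apply/fsetP => e; rewrite in_fset0.
  by apply/esym/imfsetP => -[].
have [|| l lE hl] := IH (2 * (n %/ 8) + 1); [lia | lia |].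
(* Abstracting quotient and remainder leaves linear arithmetic in [k] and [r]. *)
move: (n %/ 8) (n %% 8) (divn_eq n 8) (ltn_pmod n (isT : 0 < 8)) lE hl.
move=> k r nE r8 lE hl.
have hr : r \in [:: 1; 3; 5; 7] by rewrite !inE; lia.
rewrite (@arsE n k r) //; last by lia.
rewrite lE -edge_set_copy.
pose pairs m t b s := arch_pairs m ++ slide_pairs (2 * m) b t ++ copy_pairs s l.
have archE m : edge_set (arch_pairs m)
    = [fset [fset i; 2 * m - 1 - i] | i in iota 0 m] by exact: edge_set_map.
have slideE a b t : edge_set (slide_pairs a b t)
    = [fset [fset a + i; b + 2 * i] | i in iota 0 t] by exact: edge_set_map.
(* For residues 5 and 7 the arch size is [m = k + 1]; these identities match the explicit constants
   of the definition. *)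
have arch1 : 2 * (k + 1) - 1 = 2 * k + 1 by lia.
have slide1 : 2 * (k + 1) = 2 * k + 2 by lia.
move: nE; rewrite !inE in hr; case/or4P: hr => /eqP-> nE.
- exists (pairs k (2 * k) (4 * k + 1) (4 * k)).
    by rewrite !edge_set_cat archE slideE fsetUA.
  by apply: rainbow_pairs_step hl _ _ _ _ _ _ _ _; lia.
- exists (pairs k (2 * k + 1) (4 * k + 1) (4 * k + 2)).
    by rewrite !edge_set_cat archE slideE fsetUA.
  by apply: rainbow_pairs_step hl _ _ _ _ _ _ _ _; lia.
- exists (pairs (k + 1) (2 * k + 1) (4 * k + 4) (4 * k + 3)).
    by rewrite !edge_set_cat archE slideE fsetUA arch1 slide1.
  by apply: rainbow_pairs_step hl _ _ _ _ _ _ _ _; lia.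
- exists (pairs (k + 1) (2 * k + 2) (4 * k + 4) (4 * k + 5)).
    by rewrite !edge_set_cat archE slideE fsetUA arch1 slide1.
  by apply: rainbow_pairs_step hl _ _ _ _ _ _ _ _; lia.
Qed.

Theorem theorem3 (n : nat) : odd n -> rainbow_near_perfect_matching n (ars n).
Proof.
move=> on; have [l -> hl] := ars_rainbow_pairs on.
exact: rainbow_pairs_matching.
Qed.
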